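(* Elliptic singularities are not realized by a function satisfying the Helmholtz equation. That is, let $k>0$ and let $\psi$ be a smooth complex valued function defined near a point $(x_0,y_0)\in\mathbb{R}^2$ with $\psi(x_0,y_0)=0$ and $\psi_{xx}+\psi_{yy}+k^2\psi=0$. Then the germ of $\psi$ at $(x_0,y_0)$ is not radially equivalent to the elliptic singularity $(x,y)\mapsto x^2+y^2+\mathrm{i}y$ at the origin.
   Context: $\mathbb{C}$ is identified with $\mathbb{R}^2$ via $u+\mathrm{i}w=(u,w)$. A radial transformation near $0\in\mathbb{C}$ is a local diffeomorphism $\tau:(\mathbb{C},0)\to(\mathbb{C},0)$, $\tau(u,w)=(U,W)$, sending each radial line (ray) $\{\theta=\mathrm{const.}\}$ to a radial line, where $u+\mathrm{i}w=re^{\mathrm{i}\theta}$; equivalently $U=\rho(u,w)(au+bw)$, $W=\rho(u,w)(cu+dw)$ with $\rho$ a positive function and $a,b,c,d\in\mathbb{R}$, $ad-bc\neq0$. Two germs $\psi:(\mathbb{R}^2,p)\to(\mathbb{C},0)$ and $\varphi:(\mathbb{R}^2,q)\to(\mathbb{C},0)$ are radially equivalent if $\psi\circ\sigma=\tau\circ\varphi$ for some local diffeomorphism $\sigma:(\mathbb{R}^2,q)\to(\mathbb{R}^2,p)$ and some local radial transformation $\tau$. *)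

(* Defs.v *)
From Stdlib Require Import Reals.
From Coquelicot Require Export Coquelicot.

Open Scope R_scope.

(* Coquelicot defines [C] as [R * R], so the identification u + i w = (u, w) of
   the complex plane with the real plane holds by definition. Germs are
   represented by total functions constrained only on a neighbourhood. *)

(* [ex_diff_n h n x y] says that all iterated partial derivatives of [h] up to
   order [n] exist and are continuous, but at the single point (x, y); asking
   for it on one neighbourhood and for every [n] is C^infinity regularity. *)
Definition smooth_near (f : R * R -> R * R) (p : R * R) : Prop :=
  locally p (fun z => forall n : nat,
    ex_diff_n (fun x y => fst (f (x, y))) n (fst z) (snd z) /\
    ex_diff_n (fun x y => snd (f (x, y))) n (fst z) (snd z)).

Definition local_diffeo (f : R * R -> R * R) (p q : R * R) : Prop :=
  f p = q /\ smooth_near f p /\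
  exists g : R * R -> R * R,
    g q = p /\ smooth_near g q /\
    locally p (fun z => g (f z) = z) /\
    locally q (fun w => f (g w) = w).

Definition polar (r theta : R) : C := (r * cos theta, r * sin theta).

(* A radial line is the open ray [theta = const]. For a local diffeomorphism,
   mapping the initial segment of a ray into a ray is the same as mapping germs
   of rays onto germs of rays, by continuity. *)
Definition radial_transformation (tau : C -> C) : Prop :=
  local_diffeo tau (0, 0) (0, 0) /\
  exists eps : R, 0 < eps /\
    forall theta : R, exists theta' : R,
      forall r : R, 0 < r < eps ->
        exists r' : R, 0 < r' /\ tau (polar r theta) = polar r' theta'.

Definition radially_equivalent
    (psi : R * R -> C) (p : R * R) (phi : R * R -> C) (q : R * R) : Prop :=
  exists (sigma : R * R -> R * R) (tau : C -> C),
    local_diffeo sigma q p /\ radial_transformation tau /\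
    locally q (fun z => psi (sigma z) = tau (phi z)).

Definition Cpartial (m n : nat) (f : R * R -> C) (z : R * R) : C :=
  (partial_derive m n (fun x y => fst (f (x, y))) (fst z) (snd z),
   partial_derive m n (fun x y => snd (f (x, y))) (fst z) (snd z)).

Definition helmholtz_near (k : R) (psi : R * R -> C) (p : R * R) : Prop :=
  locally p (fun z =>
    (Cpartial 2 0 psi z + Cpartial 0 2 psi z + RtoC (k ^ 2) * psi z)%C = RtoC 0).

Definition elliptic (z : R * R) : C :=
  (RtoC (fst z ^ 2 + snd z ^ 2) + Ci * RtoC (snd z))%C.

(* Main.v *)
Require Import Defs.
From Stdlib Require Import Reals Lra.
From Coquelicot Require Import Coquelicot.
Open Scope R_scope.

(** The Helmholtz equation at the zero [p] of [psi] says that both components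
    of [psi], and hence every real linear form of them, have vanishing Laplacian
    at [p]. The elliptic singularity forbids this, because its first component
    [x^2 + y^2] is a nondegenerate minimum and radial equivalence preserves
    such a minimum up to the choice of a linear form.

    Let [L] be the differential of the radial transformation [tau] at the
    origin. Since [tau] sends rays to rays, [tau w] is a positive multiple of
    [L w], and the factor is bounded below because [tau] has a smooth inverse.
    The linear form that sends [L (u, w)] to a positive multiple of [u]
    therefore sends [tau (u, w)] to at least [c * u] on the half plane [u >= 0]
    ([radial_transformation_linear_form]). Evaluated along the elliptic
    singularity, which takes its values in that half plane, it dominates a
    positive quadratic form ([quadratic_bound_along_elliptic]). A local
    diffeomorphism of the source distorts distances by bounded factors only,
    so the same form of [psi] grows at least quadratically away from [p]
    ([local_diffeo_quadratic_bound]). Its second derivatives along both axes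
    are then positive at [p], and so is its Laplacian
    ([laplacian_ge_of_quadratic_bound]): a contradiction.

    Using growth bounds instead of Hessians keeps [sigma] and [tau] to first
    order: no second order chain rule is involved. *)

(** * First order growth of smooth maps and local diffeomorphisms *)

(** This metric has the product balls of [locally] as its balls, and it is the
    one in which [differentiable_pt_lim] measures the remainder. *)
Definition sup_dist (p z : R * R) : R :=
  Rmax (Rabs (fst z - fst p)) (Rabs (snd z - snd p)).

Lemma sup_dist_ge_0 p z : 0 <= sup_dist p z.
Proof. apply Rle_trans with (2 := Rmax_l _ _); apply Rabs_pos. Qed.

Lemma locally_sup_dist (p : R * R) (P : R * R -> Prop) :
  locally p P <-> exists delta, 0 < delta /\ forall z, sup_dist p z < delta -> P z.
Proof.
  destruct p as [x y]; unfold sup_dist; simpl; split.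
  - intros H.
    assert (H' : locally (x, y) (fun z => P (fst z, snd z))).
    { apply filter_imp with (2 := H). intros [u v]; trivial. }
    apply (proj2 (locally_2d_locally (fun u v => P (u, v)) x y)) in H'.
    destruct H' as [d Hd]. exists d; split; [apply cond_pos|].
    intros [u v] Hz; simpl in Hz. apply Hd.
    + apply Rle_lt_trans with (2 := Hz); apply Rmax_l.
    + apply Rle_lt_trans with (2 := Hz); apply Rmax_r.
  - intros [d [d0 Hd]].
    assert (H' : locally_2d (fun u v => P (u, v)) x y).
    { exists (mkposreal d d0); intros u v Hu Hv; apply Hd; simpl.
      now apply Rmax_lub_lt. }
    apply locally_2d_locally in H'.
    apply filter_imp with (2 := H'). intros [u v]; trivial.
Qed.

Lemma continuously_differentiable_pt_lim (f : R -> R -> R) (x y : R) :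
  locally (x, y) (fun z => ex_diff_n f 1 (fst z) (snd z)) ->
  differentiable_pt_lim f x y
    (Derive (fun t => f t y) x) (Derive (fun t => f x t) y).
Proof.
  intros H. apply filterdiff_differentiable_pt_lim.
  pose proof (locally_singleton _ _ H) as H0; simpl in H0.
  apply (is_derive_filterdiff f x y (fun u v => Derive (fun t => f t v) u)).
  - apply filter_imp with (2 := H). intros [u v] Hu; simpl in *.
    apply Derive_correct; apply Hu.
  - apply Derive_correct; apply H0.
  - apply (proj1 (continuity_2d_pt_filterlim
      (fun u v => Derive (fun t => f t v) u) x y)). apply H0.
Qed.

Lemma smooth_near_differentiable (f : R * R -> R * R) (p : R * R) :
  smooth_near f p -> exists a b c d,
    differentiable_pt_lim (fun x y => fst (f (x, y))) (fst p) (snd p) a b /\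
    differentiable_pt_lim (fun x y => snd (f (x, y))) (fst p) (snd p) c d.
Proof.
  destruct p as [x y]; intros H.
  do 4 eexists; split; apply continuously_differentiable_pt_lim;
    apply filter_imp with (2 := H); intros z Hz; apply (Hz 1%nat).
Qed.

Lemma differentiable_pt_lim_growth (f : R -> R -> R) (x y a b : R) :
  differentiable_pt_lim f x y a b ->
  locally (x, y) (fun z =>
    Rabs (f (fst z) (snd z) - f x y) <= (1 + Rabs a + Rabs b) * sup_dist (x, y) z).
Proof.
  intros H. apply (proj1 (locally_2d_locally (fun u v =>
    Rabs (f u v - f x y) <= (1 + Rabs a + Rabs b) * sup_dist (x, y) (u, v)) x y)).
  destruct (H (mkposreal 1 Rlt_0_1)) as [d Hd]. exists d; intros u v Hu Hv.
  specialize (Hd u v Hu Hv). simpl in Hd. unfold sup_dist; simpl.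
  set (m := Rmax _ _) in *.
  assert (Rabs (u - x) <= m) by apply Rmax_l.
  assert (Rabs (v - y) <= m) by apply Rmax_r.
  assert (Rabs (a * (u - x)) <= Rabs a * m)
    by (rewrite Rabs_mult; apply Rmult_le_compat_l; [apply Rabs_pos | easy]).
  assert (Rabs (b * (v - y)) <= Rabs b * m)
    by (rewrite Rabs_mult; apply Rmult_le_compat_l; [apply Rabs_pos | easy]).
  replace (f u v - f x y) with
    ((f u v - f x y - (a * (u - x) + b * (v - y))) + a * (u - x) + b * (v - y)) by ring.
  eapply Rle_trans; [apply Rabs_triang|].
  eapply Rle_trans; [apply Rplus_le_compat_r, Rabs_triang|]. lra.
Qed.

(** Differentiability at the single point [p] is enough, because the bound is
    centred at [p]. *)
Lemma smooth_near_growth (f : R * R -> R * R) (p : R * R) :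
  smooth_near f p -> exists K, 0 < K /\
    locally p (fun z => sup_dist (f p) (f z) <= K * sup_dist p z).
Proof.
  intros H. destruct (smooth_near_differentiable f p H) as (a & b & c & d & H1 & H2).
  destruct p as [x y]; simpl in H1, H2.
  apply differentiable_pt_lim_growth in H1. apply differentiable_pt_lim_growth in H2.
  pose proof (Rabs_pos a); pose proof (Rabs_pos b);
  pose proof (Rabs_pos c); pose proof (Rabs_pos d).
  exists (1 + Rabs a + Rabs b + Rabs c + Rabs d); split; [lra|].
  generalize (filter_and _ _ H1 H2); apply filter_imp; intros [u v] [G1 G2].
  simpl in G1, G2.
  pose proof (sup_dist_ge_0 (x, y) (u, v)).
  unfold sup_dist at 1; simpl.
  apply Rmax_lub; [apply Rle_trans with (1 := G1) | apply Rle_trans with (1 := G2)];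
    (apply Rmult_le_compat_r; [assumption | lra]).
Qed.

Lemma smooth_near_locally (f : R * R -> R * R) (p : R * R) (P : R * R -> Prop) :
  smooth_near f p -> locally (f p) P -> locally p (fun z => P (f z)).
Proof.
  intros Hf HP. destruct (smooth_near_growth f p Hf) as (M & HM & HfM).
  apply locally_sup_dist in HP; destruct HP as (d & Hd & HP).
  assert (Hnear : locally p (fun z => sup_dist p z < d / M)).
  { apply locally_sup_dist. exists (d / M); split; [|easy].
    now apply Rdiv_lt_0_compat. }
  generalize (filter_and _ _ Hnear HfM). apply filter_imp; intros z (Hz & HzM).
  apply HP, Rle_lt_trans with (1 := HzM).
  apply Rmult_lt_compat_l with (r := M) in Hz; [|easy].
  now replace (M * (d / M)) with d in Hz by (field; lra).
Qed.

(** This is the upper growth bound of the inverse map, read at [f z]. *)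
Lemma local_diffeo_growth (f : R * R -> R * R) (p q : R * R) :
  local_diffeo f p q -> exists K, 0 < K /\
    locally p (fun z => sup_dist p z <= K * sup_dist q (f z)).
Proof.
  intros (<- & Hf & g & Hg0 & Hg & Hgf & _).
  destruct (smooth_near_growth g (f p) Hg) as (K & HK & HgK).
  exists K; split; [easy|].
  apply (smooth_near_locally f p _ Hf) in HgK.
  generalize (filter_and _ _ HgK Hgf). apply filter_imp; intros z [Hz Hgz].
  now rewrite Hg0, Hgz in Hz.
Qed.

(** * Second derivatives of functions with quadratic growth *)

Lemma derive_ge_of_right_bound (h : R -> R) (x l k : R) :
  is_derive h x l ->
  (exists e, 0 < e /\ forall t, 0 < t < e -> h x + k * t <= h (x + t)) -> k <= l.
Proof.
  intros Hd (e & He & H). apply is_derive_Reals in Hd.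
  destruct (Rle_lt_dec k l) as [|Hlt]; [easy|exfalso].
  destruct (Hd (k - l)) as [d Hd']; [lra|].
  pose proof (cond_pos d).
  set (t := Rmin d e / 2).
  assert (0 < Rmin d e) by now apply Rmin_pos.
  pose proof (Rmin_l d e); pose proof (Rmin_r d e).
  assert (Ht : 0 < t) by (unfold t; lra).
  assert (Htd : Rabs t < d) by (rewrite Rabs_pos_eq; unfold t; lra).
  specialize (Hd' t (Rgt_not_eq _ _ Ht) Htd).
  apply Rabs_def2 in Hd'. destruct Hd' as [Hd' _].
  assert (Hq : k <= (h (x + t) - h x) / t).
  { apply Rle_div_r; [easy|]. assert (h x + k * t <= h (x + t)) by (apply H; unfold t in *; lra). lra. }
  lra.
Qed.

(** The growth bound makes [x] a minimum, so [h1 x = 0]. If [h2] were less than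
    [2 * c], then [h1] would lie below a line of slope [s < 2 * c] to the right
    of [x], and integrating would put [h] below [s / 2 * (t - x) ^ 2]. *)
Lemma second_derive_ge_of_quadratic_bound (h h1 : R -> R) (x h2 c : R) :
  locally x (fun t => is_derive h t (h1 t)) -> is_derive h1 x h2 ->
  h x = 0 -> locally x (fun t => c * (t - x) ^ 2 <= h t) -> 0 <= c ->
  2 * c <= h2.
Proof.
  intros Hh Hh1 Hx Hc Hc0.
  pose proof (locally_singleton _ _ Hh) as Hhx; simpl in Hhx.
  destruct (filter_and _ _ Hh Hc) as [e He].
  assert (Hball : forall t, Rabs (t - x) < e ->
            is_derive h t (h1 t) /\ c * (t - x) ^ 2 <= h t) by exact He.
  clear He Hh Hc. pose proof (cond_pos e) as He.
  assert (Hcrit : h1 x = 0).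
  { apply Rle_antisym.
    (* Reflecting at [x] turns the bound on the left of [x] into one on its right. *)
    - enough (0 <= - h1 x) by lra.
      apply (derive_ge_of_right_bound (fun t => h (2 * x - t)) x).
      + auto_derive; [|].
        { exists (h1 x). now replace (2 * x + - x) with x by ring. }
        replace (2 * x + - x) with x by ring.
        change (- (1) * Derive h x = - h1 x).
        rewrite (is_derive_unique _ _ _ Hhx); ring.
      + exists e; split; [easy|]. intros t Ht.
        replace (2 * x - x) with x by ring. rewrite Hx.
        destruct (Hball (2 * x - (x + t))) as [_ H].
        * rewrite Rabs_left; lra.
        * nra.
    - apply (derive_ge_of_right_bound h x); [easy|].
      exists e; split; [easy|]. intros t Ht. rewrite Hx.
      destruct (Hball (x + t)) as [_ H].
      + rewrite Rabs_pos_eq; lra.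
      + nra. }
  destruct (Rle_lt_dec (2 * c) h2) as [|Hlt]; [easy|exfalso].
  (* Any slope strictly between [h2] and [2 * c] would do. *)
  set (s := (h2 + 2 * c) / 2).
  apply is_derive_Reals in Hh1.
  destruct (Hh1 (s - h2)) as [d Hd]; [unfold s; lra|].
  pose proof (cond_pos d).
  assert (0 < Rmin d e) by now apply Rmin_pos.
  pose proof (Rmin_l d e); pose proof (Rmin_r d e).
  set (t := Rmin d e / 2).
  assert (Ht : 0 < t) by (unfold t; lra).
  assert (Hslope : forall u, x <= u <= x + t -> h1 u <= s * (u - x)).
  { intros u Hu. destruct (Req_dec u x) as [->|Hux]; [lra|].
    assert (Hu0 : u - x <> 0) by lra.
    specialize (Hd (u - x) Hu0).
    assert (Hud : Rabs (u - x) < d) by (rewrite Rabs_pos_eq; unfold t in *; lra).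
    apply Hd, Rabs_def2 in Hud. destruct Hud as [Hud _].
    replace (x + (u - x)) with u in Hud by ring. rewrite Hcrit, Rminus_0_r in Hud.
    apply Rle_div_l; lra. }
  assert (Hder : forall u, x <= u <= x + t ->
    is_derive (fun u => h u - s / 2 * (u - x) ^ 2) u (h1 u - s * (u - x))).
  { intros u Hu. destruct (Hball u) as [Hu1 _].
    { rewrite Rabs_pos_eq; unfold t in *; lra. }
    auto_derive; [now exists (h1 u)|].
    change (Derive (fun u => h u)) with (Derive h).
    rewrite (is_derive_unique _ _ _ Hu1); field. }
  destruct (MVT_gen (fun u => h u - s / 2 * (u - x) ^ 2) x (x + t)
              (fun u => h1 u - s * (u - x))) as (u & Hu & Heq);
    rewrite ?Rmin_left, ?Rmax_right in * by lra.
  - intros u Hu. apply Hder; lra.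
  - intros u Hu. apply derivable_continuous_pt.
    exists (h1 u - s * (u - x)). now apply is_derive_Reals, Hder.
  - specialize (Hslope u Hu).
    destruct (Hball (x + t)) as [_ Hlow].
    { rewrite Rabs_pos_eq; unfold t in *; lra. }
    rewrite Hx in Heq.
    replace (x + t - x) with t in * by ring. replace (x - x) with 0 in Heq by ring.
    assert ((h1 u - s * (u - x)) * t <= 0) by nra.
    assert (0 < (c - s / 2) * t ^ 2)
      by (apply Rmult_lt_0_compat; [unfold s; lra | now apply pow_lt]).
    lra.
Qed.

Lemma ex_diff_n_2_second_derivatives (f : R -> R -> R) (x y : R) :
  locally (x, y) (fun z => ex_diff_n f 2 (fst z) (snd z)) ->
  (locally x (fun t => is_derive (fun s => f s y) t (Derive (fun s => f s y) t)) /\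
   is_derive (Derive (fun s => f s y)) x (partial_derive 2 0 f x y)) /\
  (locally y (fun t => is_derive (fun s => f x s) t (Derive (fun s => f x s) t)) /\
   is_derive (Derive (fun s => f x s)) y (partial_derive 0 2 f x y)).
Proof.
  intros H. pose proof (locally_singleton _ _ H) as H0; simpl in H0.
  apply (proj2 (locally_2d_locally (fun u v => ex_diff_n f 2 u v) x y)) in H.
  split; split.
  - generalize (locally_2d_1d_const_y _ _ _ H). apply filter_imp; intros t Ht.
    apply Derive_correct, Ht.
  - apply Derive_correct, H0.
  - generalize (locally_2d_1d_const_x _ _ _ H). apply filter_imp; intros t Ht.
    apply Derive_correct, Ht.
  - apply Derive_correct, H0.
Qed.

(** Restricting to the two coordinate lines reduces this to one variable. It is
    stated for a combination of two functions because it is meant for linear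
    forms of a complex valued function. *)
Lemma laplacian_ge_of_quadratic_bound (f g : R -> R -> R) (x y al be c : R) :
  locally (x, y) (fun z => ex_diff_n f 2 (fst z) (snd z)) ->
  locally (x, y) (fun z => ex_diff_n g 2 (fst z) (snd z)) ->
  al * f x y + be * g x y = 0 -> 0 <= c ->
  locally (x, y) (fun z =>
    c * sup_dist (x, y) z ^ 2 <= al * f (fst z) (snd z) + be * g (fst z) (snd z)) ->
  4 * c <= al * (partial_derive 2 0 f x y + partial_derive 0 2 f x y)
         + be * (partial_derive 2 0 g x y + partial_derive 0 2 g x y).
Proof.
  intros Hf Hg H0 Hc Hq.
  apply ex_diff_n_2_second_derivatives in Hf.
  apply ex_diff_n_2_second_derivatives in Hg.
  destruct Hf as [[Hfx Hfxx] [Hfy Hfyy]], Hg as [[Hgx Hgxx] [Hgy Hgyy]].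
  apply (proj2 (locally_2d_locally (fun u v =>
    c * sup_dist (x, y) (u, v) ^ 2 <= al * f u v + be * g u v) x y)) in Hq.
  assert (Hlin : forall (p q : R -> R) t p' q',
    is_derive p t p' -> is_derive q t q' ->
    is_derive (fun s => al * p s + be * q s) t (al * p' + be * q')).
  { intros p q t p' q' Hp Hq'.
    exact (is_derive_plus _ _ _ _ _ (is_derive_scal p t al p' Hp)
             (is_derive_scal q t be q' Hq')). }
  assert (Hxx : 2 * c <= al * partial_derive 2 0 f x y + be * partial_derive 2 0 g x y).
  { apply (second_derive_ge_of_quadratic_bound (fun s => al * f s y + be * g s y)
      (fun t => al * Derive (fun s => f s y) t + be * Derive (fun s => g s y) t) x); auto.
    - generalize (filter_and _ _ Hfx Hgx). apply filter_imp; intros t [Ht1 Ht2]; auto.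
    - generalize (locally_2d_1d_const_y _ _ _ Hq). apply filter_imp; intros t Ht.
      rewrite <- pow2_abs. apply Rle_trans with (2 := Ht), Rmult_le_compat_l; [easy|].
      apply pow_incr; split; [apply Rabs_pos | apply Rmax_l]. }
  assert (Hyy : 2 * c <= al * partial_derive 0 2 f x y + be * partial_derive 0 2 g x y).
  { apply (second_derive_ge_of_quadratic_bound (fun s => al * f x s + be * g x s)
      (fun t => al * Derive (fun s => f x s) t + be * Derive (fun s => g x s) t) y); auto.
    - generalize (filter_and _ _ Hfy Hgy). apply filter_imp; intros t [Ht1 Ht2]; auto.
    - generalize (locally_2d_1d_const_x _ _ _ Hq). apply filter_imp; intros t Ht.
      rewrite <- pow2_abs. apply Rle_trans with (2 := Ht), Rmult_le_compat_l; [easy|].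
      apply pow_incr; split; [apply Rabs_pos | apply Rmax_r]. }
  lra.
Qed.

(** * Radial transformations *)

Lemma polar_surjective (u w : R) :
  u <> 0 \/ w <> 0 -> exists r theta, 0 < r /\ (u, w) = polar r theta.
Proof.
  intros Hnz. set (r := sqrt (u ^ 2 + w ^ 2)).
  assert (Hs : 0 < u ^ 2 + w ^ 2) by (destruct Hnz; nra).
  assert (Hr : 0 < r) by now apply sqrt_lt_R0.
  assert (Hr2 : r * r = u ^ 2 + w ^ 2) by (apply sqrt_sqrt; lra).
  set (x := u / r).
  assert (Hu : u = r * x) by (unfold x; field; lra).
  assert (Hx1 : x * x <= 1) by nra.
  assert (Hx : -1 <= x <= 1) by nra.
  assert (Hw : Rabs w = r * sqrt (1 - x²)).
  { rewrite <- sqrt_Rsqr_abs, <- (sqrt_Rsqr r) at 1 by lra.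
    rewrite <- sqrt_mult_alt by apply Rle_0_sqr. f_equal. unfold Rsqr. nra. }
  unfold polar. destruct (Rle_lt_dec 0 w) as [Hw0 | Hw0].
  - exists r, (acos x). rewrite cos_acos, sin_acos, <- Hw, Rabs_pos_eq by easy.
    split; [easy | now f_equal].
  - exists r, (- acos x). rewrite cos_neg, sin_neg, cos_acos, sin_acos by easy.
    split; [easy|]. rewrite Rabs_left in Hw by easy. f_equal; lra.
Qed.

Lemma sup_dist_polar_ge (r theta : R) :
  0 < r -> r / 2 <= sup_dist (0, 0) (polar r theta).
Proof.
  intros Hr. unfold sup_dist, polar; simpl. rewrite !Rminus_0_r, !Rabs_mult.
  rewrite (Rabs_pos_eq r) by lra.
  pose proof (sin2_cos2 theta) as H. unfold Rsqr in H.
  pose proof (Rmax_l (r * Rabs (cos theta)) (r * Rabs (sin theta))).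
  pose proof (Rmax_r (r * Rabs (cos theta)) (r * Rabs (sin theta))).
  destruct (Rle_lt_dec (/ 2) (Rabs (cos theta))) as [|Hc]; [nra|].
  destruct (Rle_lt_dec (/ 2) (Rabs (sin theta))) as [|Hs]; [nra|].
  apply Rabs_def2 in Hc. apply Rabs_def2 in Hs. nra.
Qed.

Lemma sup_dist_polar_le (r theta : R) :
  0 <= r -> sup_dist (0, 0) (polar r theta) <= r.
Proof.
  intros Hr. unfold sup_dist, polar; simpl. rewrite !Rminus_0_r, !Rabs_mult.
  rewrite (Rabs_pos_eq r) by lra.
  assert (Rabs (cos theta) <= 1) by (apply Rabs_le, COS_bound).
  assert (Rabs (sin theta) <= 1) by (apply Rabs_le, SIN_bound).
  apply Rmax_lub; nra.
Qed.

Lemma derive_along_ray (f : R -> R -> R) (a b theta : R) :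
  differentiable_pt_lim f 0 0 a b ->
  is_derive (fun t => f (t * cos theta) (t * sin theta)) 0
    (a * cos theta + b * sin theta).
Proof.
  intros H. apply is_derive_Reals.
  apply (derivable_pt_lim_comp_2d f (fun t => t * cos theta) (fun t => t * sin theta)).
  - now rewrite !Rmult_0_l.
  - apply is_derive_Reals. auto_derive; [easy | ring].
  - apply is_derive_Reals. auto_derive; [easy | ring].
Qed.

(** Both the cross product of the image with the direction [theta'] (identically
    zero) and its inner product with it (at least [k * r]) are linear in the
    image, so these bounds pass to the derivative at [r = 0]. Thus the
    differential sends the ray into the same target ray, with a quantitative
    nondegeneracy [k <= m]. *)
Lemma differential_along_radial_ray
  (f g : R -> R -> R) (a b c d theta theta' k e : R) :
  differentiable_pt_lim f 0 0 a b -> differentiable_pt_lim g 0 0 c d ->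
  f 0 0 = 0 -> g 0 0 = 0 -> 0 < e ->
  (forall r, 0 < r < e -> exists r', k * r <= r' /\
     (f (r * cos theta) (r * sin theta), g (r * cos theta) (r * sin theta))
       = polar r' theta') ->
  exists m, k <= m /\
    a * cos theta + b * sin theta = m * cos theta' /\
    c * cos theta + d * sin theta = m * sin theta'.
Proof.
  intros Hf Hg Hf0 Hg0 He Hray.
  apply (derive_along_ray _ _ _ theta) in Hf.
  apply (derive_along_ray _ _ _ theta) in Hg.
  set (p := a * cos theta + b * sin theta) in *.
  set (q := c * cos theta + d * sin theta) in *.
  pose proof (sin2_cos2 theta') as Hsc. unfold Rsqr in Hsc.
  assert (Hbound : forall al be l,
    (forall r r', 0 < r < e -> k * r <= r' ->
       l * r <= al * (r' * cos theta') + be * (r' * sin theta')) ->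
    l <= al * p + be * q).
  { intros al be l H.
    apply (derive_ge_of_right_bound
      (fun t => al * f (t * cos theta) (t * sin theta)
              + be * g (t * cos theta) (t * sin theta)) 0).
    - exact (is_derive_plus _ _ _ _ _ (is_derive_scal _ _ al _ Hf)
               (is_derive_scal _ _ be _ Hg)).
    - exists e; split; [easy|]. intros t Ht.
      destruct (Hray t Ht) as (r' & Hr' & Hpol).
      injection Hpol as Hp1 Hp2.
      rewrite Rplus_0_l, !Rmult_0_l, Hf0, Hg0, Hp1, Hp2.
      specialize (H t r' Ht Hr'). lra. }
  assert (Hc1 : 0 <= sin theta' * p + - cos theta' * q)
    by (apply Hbound; intros; lra).
  assert (Hc2 : 0 <= - sin theta' * p + cos theta' * q)
    by (apply Hbound; intros; lra).
  assert (Hdot : k <= cos theta' * p + sin theta' * q).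
  { apply Hbound; intros r r' _ Hr'.
    replace (cos theta' * (r' * cos theta') + sin theta' * (r' * sin theta'))
      with (r' * (sin theta' * sin theta' + cos theta' * cos theta')) by ring.
    rewrite Hsc; lra. }
  exists (cos theta' * p + sin theta' * q). split; [easy|].
  assert (Hcross : sin theta' * p = cos theta' * q) by lra.
  split.
  - transitivity (p * (sin theta' * sin theta' + cos theta' * cos theta'));
      [rewrite Hsc; ring|].
    replace (p * (sin theta' * sin theta' + cos theta' * cos theta'))
      with (sin theta' * (sin theta' * p) + cos theta' * cos theta' * p) by ring.
    rewrite Hcross; ring.
  - transitivity (q * (sin theta' * sin theta' + cos theta' * cos theta'));
      [rewrite Hsc; ring|].
    replace (q * (sin theta' * sin theta' + cos theta' * cos theta'))
      with (sin theta' * sin theta' * q + cos theta' * (cos theta' * q)) by ring.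
    rewrite <- Hcross; ring.
Qed.

(** If the determinant vanished, then [(b, - a)] and [(d, - c)] would lie in the
    kernel, which is trivial because the matrix kills no unit vector. *)
Lemma det_neq_0_of_unit_circle (a b c d : R) :
  (forall theta, 0 < (a * cos theta + b * sin theta) ^ 2
                   + (c * cos theta + d * sin theta) ^ 2) ->
  a * d - b * c <> 0.
Proof.
  intros H Hdet.
  assert (Hker : forall u w, a * u + b * w = 0 -> c * u + d * w = 0 -> u = 0 /\ w = 0).
  { intros u w H1 H2.
    assert (Hz : ~ (u <> 0 \/ w <> 0)).
    { intros Hnz. destruct (polar_surjective u w Hnz) as (r & theta & Hr & Heq).
      injection Heq as -> ->. specialize (H theta).
      assert (a * cos theta + b * sin theta = 0) by (apply Rmult_eq_reg_l with r; lra).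
      assert (c * cos theta + d * sin theta = 0) by (apply Rmult_eq_reg_l with r; lra).
      nra. }
    destruct (Req_dec u 0), (Req_dec w 0); tauto. }
  destruct (Hker b (- a)) as [Hb Ha]; [ring | lra |].
  destruct (Hker d (- c)) as [Hd Hc]; [lra | ring |].
  destruct (Hker 1 0); nra.
Qed.

(** With [L = (a, b; c, d)] the differential at the origin and [D = det L], the
    form [D * (d * U - b * W)] takes the value [D ^ 2 * u] at [L (u, w)]. On the
    ray of angle [theta], [L] maps the unit vector to [m] times the unit vector
    of angle [theta'] and [tau] maps [polar r theta] to [r'] times it, so that
    [tau = (r' / m) * L] there. The bounds [k * r <= r'] and [m <= M] hold for
    all angles simultaneously and give the constant [k * D ^ 2 / M]. *)
Lemma radial_transformation_linear_form (tau : C -> C) :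
  radial_transformation tau -> exists al be k, 0 < k /\
    locally ((0, 0) : R * R) (fun w : R * R => 0 <= fst w ->
      k * fst w <= al * fst (tau w) + be * snd (tau w)).
Proof.
  intros (Hdiff & eps & Heps & Hrad).
  destruct (local_diffeo_growth _ _ _ Hdiff) as (K & HK & Hgrow).
  destruct Hdiff as (Htau0 & Hsm & _).
  destruct (smooth_near_differentiable _ _ Hsm) as (a & b & c & d & Hf & Hg).
  simpl in Hf, Hg.
  apply locally_sup_dist in Hgrow; destruct Hgrow as (dl & Hdl & Hgrow).
  set (e := Rmin eps dl).
  assert (He : 0 < e) by now apply Rmin_pos.
  assert (He1 : e <= eps) by apply Rmin_l.
  assert (He2 : e <= dl) by apply Rmin_r.
  (* The 2 pays for comparing the Euclidean radius with the sup distance. *)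
  set (k := / (2 * K)).
  assert (Hk : 0 < k) by (apply Rinv_0_lt_compat; lra).
  assert (Hray : forall theta, exists theta', forall r, 0 < r < e -> exists r',
            k * r <= r' /\ tau (polar r theta) = polar r' theta').
  { intros theta. destruct (Hrad theta) as [theta' H]. exists theta'.
    intros r Hr. destruct (H r) as (r' & Hr' & Heq); [lra|].
    exists r'; split; [|easy].
    assert (Hb : sup_dist (0, 0) (polar r theta) < dl).
    { apply Rle_lt_trans with r; [apply sup_dist_polar_le|]; lra. }
    apply Hgrow in Hb. rewrite Heq in Hb.
    assert (r / 2 <= sup_dist (0, 0) (polar r theta)) by now apply sup_dist_polar_ge.
    assert (K * sup_dist (0, 0) (polar r' theta') <= K * r')
      by (apply Rmult_le_compat_l; [|apply sup_dist_polar_le]; lra).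
    apply Rmult_le_reg_l with (2 * K); [lra|].
    unfold k. rewrite <- Rmult_assoc, Rinv_r by lra. lra. }
  assert (Hlin : forall theta, exists theta' m, k <= m /\
      a * cos theta + b * sin theta = m * cos theta' /\
      c * cos theta + d * sin theta = m * sin theta' /\
      forall r, 0 < r < e -> exists r',
            k * r <= r' /\ tau (polar r theta) = polar r' theta').
  { intros theta. destruct (Hray theta) as [theta' H]. exists theta'.
    destruct (differential_along_radial_ray _ _ a b c d theta theta' k e Hf Hg)
      as (m & Hm & H1 & H2); try easy;
      try now rewrite Htau0.
    - intros r Hr. destruct (H r Hr) as (r' & Hr' & Heq).
      exists r'; split; [easy|]. rewrite <- Heq. now rewrite <- surjective_pairing.
    - now exists m. }
  set (D := a * d - b * c).
  assert (HD : D <> 0).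
  { apply det_neq_0_of_unit_circle. intros theta.
    destruct (Hlin theta) as (theta' & m & Hm & -> & -> & _).
    pose proof (sin2_cos2 theta') as Hsc. unfold Rsqr in Hsc.
    replace ((m * cos theta') ^ 2 + (m * sin theta') ^ 2)
      with (m ^ 2 * (sin theta' * sin theta' + cos theta' * cos theta')) by ring.
    rewrite Hsc. nra. }
  set (M := Rabs a + Rabs b + Rabs c + Rabs d).
  assert (HM : forall theta theta' m, a * cos theta + b * sin theta = m * cos theta' ->
      c * cos theta + d * sin theta = m * sin theta' -> m <= M).
  { intros theta theta' m H1 H2.
    pose proof (sin2_cos2 theta') as Hsc. unfold Rsqr in Hsc.
    assert (Hu : forall x y z, -1 <= y <= 1 -> -1 <= z <= 1 -> x * (y * z) <= Rabs x).
    { intros x y z Hy Hz. apply Rle_trans with (1 := Rle_abs _).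
      rewrite !Rabs_mult. apply Rabs_le in Hy. apply Rabs_le in Hz.
      pose proof (Rabs_pos x). pose proof (Rabs_pos y). pose proof (Rabs_pos z).
      assert (Rabs y * Rabs z <= 1) by nra. nra. }
    replace m with (m * cos theta' * cos theta' + m * sin theta' * sin theta')
      by (transitivity (m * (sin theta' * sin theta' + cos theta' * cos theta'));
          [ring | rewrite Hsc; ring]).
    rewrite <- H1, <- H2. unfold M.
    pose proof (COS_bound theta). pose proof (SIN_bound theta).
    pose proof (COS_bound theta'). pose proof (SIN_bound theta').
    pose proof (Hu a (cos theta) (cos theta')). pose proof (Hu b (sin theta) (cos theta')).
    pose proof (Hu c (cos theta) (sin theta')). pose proof (Hu d (sin theta) (sin theta')).
    lra. }
  assert (HM0 : 0 < M).
  { destruct (Hlin 0) as (theta' & m & Hm & H1 & H2 & _).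
    pose proof (HM _ _ _ H1 H2). lra. }
  exists (D * d), (- D * b), (k * D ^ 2 / M). split.
  { apply Rdiv_lt_0_compat; [|easy]. apply Rmult_lt_0_compat; [easy|]. now apply pow2_gt_0. }
  assert (Hpolar : forall r theta, 0 < r < e -> 0 <= r * cos theta ->
    k * D ^ 2 / M * (r * cos theta)
      <= D * d * fst (tau (polar r theta)) + - D * b * snd (tau (polar r theta))).
  { intros r theta Hr Hcos.
    destruct (Hlin theta) as (theta' & m & Hm & H1 & H2 & Htau).
    pose proof (HM _ _ _ H1 H2) as HmM.
    destruct (Htau r Hr) as (r' & Hr' & ->).
    unfold polar; simpl fst; simpl snd.
    set (y := D * (d * cos theta' - b * sin theta')).
    assert (Hmy : m * y = D ^ 2 * cos theta).
    { unfold y. transitivity (D * (d * (m * cos theta') - b * (m * sin theta'))); [ring|].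
      rewrite <- H1, <- H2. unfold D. ring. }
    assert (Hc0 : 0 <= cos theta) by (apply Rmult_le_reg_l with r; lra).
    assert (HDc : 0 <= D ^ 2 * cos theta)
      by (apply Rmult_le_pos; [apply pow2_ge_0 | easy]).
    assert (Hy : 0 <= y) by (apply Rmult_le_reg_l with m; lra).
    assert (HyM : D ^ 2 * cos theta / M <= y).
    { apply Rle_div_l; [easy|]. rewrite <- Hmy. nra. }
    replace (k * D ^ 2 / M * (r * cos theta))
      with (k * r * (D ^ 2 * cos theta / M)) by (field; lra).
    replace (D * d * (r' * cos theta') + - D * b * (r' * sin theta'))
      with (r' * y) by (unfold y; ring).
    assert (0 < k * r) by (apply Rmult_lt_0_compat; lra).
    apply Rle_trans with (k * r * y).
    - apply Rmult_le_compat_l; lra.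
    - apply Rmult_le_compat_r; lra. }
  (* Sup distance below [e / 2] forces the radius below [e]. *)
  apply locally_sup_dist. exists (e / 2); split; [lra|].
  intros [u w] Hw Hu. simpl in Hu |- *.
  assert (Hcase : (u = 0 /\ w = 0) \/ (u <> 0 \/ w <> 0)).
  { destruct (Req_dec u 0); destruct (Req_dec w 0); tauto. }
  destruct Hcase as [[-> ->] | Hnz].
  - rewrite Htau0; simpl; lra.
  - destruct (polar_surjective u w Hnz) as (r & theta & Hr & Heq).
    rewrite Heq in Hw |- *. injection Heq as -> _.
    apply Hpolar; [|easy].
    pose proof (sup_dist_polar_ge r theta Hr). lra.
Qed.

(** * Transport of the quadratic minimum *)

(** A point at distance [t] from [p] has its preimage at distance at least
    [t / K] from [q], where [K] bounds the growth of [sigma]. *)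
Lemma local_diffeo_quadratic_bound
  (f : R * R -> R) (sigma : R * R -> R * R) (q p : R * R) (c : R) :
  local_diffeo sigma q p -> 0 < c ->
  locally q (fun z => c * sup_dist q z ^ 2 <= f (sigma z)) ->
  exists c', 0 < c' /\ locally p (fun z => c' * sup_dist p z ^ 2 <= f z).
Proof.
  intros (Hsq & Hsm & s & Hsp & Hsms & _ & Hsigs) Hc Hf.
  destruct (smooth_near_growth sigma q Hsm) as (K & HK & HsigK).
  rewrite Hsq in HsigK.
  exists (c / K ^ 2); split; [apply Rdiv_lt_0_compat; [easy | now apply pow_lt]|].
  pose proof (fun P => smooth_near_locally s p P Hsms) as Hs. rewrite Hsp in Hs.
  generalize (filter_and _ _ Hsigs (Hs _ (filter_and _ _ Hf HsigK))).
  apply filter_imp; intros z (Hz & H1 & H2). rewrite Hz in H1, H2.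
  apply Rle_trans with (2 := H1).
  replace (c / K ^ 2 * sup_dist p z ^ 2)
    with (c * (sup_dist p z / K) ^ 2) by (field; lra).
  apply Rmult_le_compat_l; [lra|]. apply pow_incr; split.
  - apply Rdiv_le_0_compat; [apply sup_dist_ge_0 | easy].
  - apply Rle_div_l; lra.
Qed.

(** Near the origin [elliptic] takes values in the half plane where the
    hypothesis applies, and its first component [x ^ 2 + y ^ 2] dominates the
    squared sup distance. *)
Lemma quadratic_bound_along_elliptic (f : R * R -> R) (k : R) :
  0 < k ->
  locally ((0, 0) : R * R) (fun w : R * R => 0 <= fst w -> k * fst w <= f w) ->
  locally ((0, 0) : R * R) (fun z : R * R =>
    k * sup_dist (0, 0) z ^ 2 <= f (elliptic z)).
Proof.
  intros Hk Hf. apply locally_sup_dist in Hf. destruct Hf as (dl & Hdl & Hf).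
  apply locally_sup_dist. exists (Rmin (dl / 2) (/ 2)); split; [apply Rmin_pos; lra|].
  intros [x y] Hz.
  pose proof (Rmin_l (dl / 2) (/ 2)). pose proof (Rmin_r (dl / 2) (/ 2)).
  replace (elliptic (x, y)) with (x ^ 2 + y ^ 2, y)
    by (unfold elliptic, RtoC, Ci, Cplus, Cmult; simpl; f_equal; ring).
  unfold sup_dist in Hz |- *; simpl fst in *; simpl snd in *.
  rewrite !Rminus_0_r in *.
  set (n := Rmax (Rabs x) (Rabs y)) in *.
  assert (Rabs x <= n) by apply Rmax_l.
  assert (Rabs y <= n) by apply Rmax_r.
  pose proof (Rabs_pos x). pose proof (Rabs_pos y).
  pose proof (pow2_abs x). pose proof (pow2_abs y).
  assert (Hn : n ^ 2 <= x ^ 2 + y ^ 2) by (unfold n, Rmax; destruct (Rle_dec _ _); nra).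
  assert (Hpos : 0 <= x ^ 2 + y ^ 2) by nra.
  apply Rle_trans with (k * (x ^ 2 + y ^ 2)).
  - apply Rmult_le_compat_l; lra.
  - refine (Hf (x ^ 2 + y ^ 2, y) _ Hpos).
    unfold sup_dist; cbn [fst snd]. rewrite !Rminus_0_r.
    rewrite (Rabs_pos_eq _ Hpos). apply Rmax_lub_lt; nra.
Qed.

Theorem proposition3p2 (k : R) (hk : 0 < k)
  (psi : R * R -> C) (x0 y0 : R)
  (hsmooth : smooth_near psi (x0, y0))
  (hzero : psi (x0, y0) = RtoC 0)
  (hhelm : helmholtz_near k psi (x0, y0)) :
  ~ radially_equivalent psi (x0, y0) elliptic (0, 0).
Proof.
  intros (sigma & tau & Hsigma & Htau & Heq).
  destruct (radial_transformation_linear_form tau Htau) as (al & be & c & Hc & Hform).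
  apply (quadratic_bound_along_elliptic
    (fun w => al * fst (tau w) + be * snd (tau w)) c Hc) in Hform.
  destruct (local_diffeo_quadratic_bound
    (fun z => al * fst (psi z) + be * snd (psi z)) sigma _ _ c Hsigma Hc)
    as (c' & Hc' & Hquad).
  { generalize (filter_and _ _ Heq Hform). apply filter_imp; intros z [-> Hz]. exact Hz. }
  (* At [p] the zeroth order term vanishes, so only the Laplacian remains. *)
  apply locally_singleton in hhelm. rewrite hzero in hhelm.
  unfold Cpartial, RtoC, Cplus, Cmult in hhelm. simpl fst in hhelm. simpl snd in hhelm.
  injection hhelm as Hre Him.
  enough (4 * c' <= 0) by lra.
  eapply Rle_trans.
  - apply (laplacian_ge_of_quadratic_bound
      (fun x y => fst (psi (x, y))) (fun x y => snd (psi (x, y))) x0 y0 al be).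
    + apply filter_imp with (2 := hsmooth); intros z Hz; apply (Hz 2%nat).
    + apply filter_imp with (2 := hsmooth); intros z Hz; apply (Hz 2%nat).
    + rewrite hzero; simpl; ring.
    + lra.
    + generalize Hquad. apply filter_imp; intros [u v]; trivial.
  - apply Req_le. transitivity (al * 0 + be * 0); [|ring]. f_equal; f_equal; lra.
Qed.
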